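(* Let $m$ be a positive integer and $q=2^m$. Then $$f(x)=x+x^{4q^2+1}+x^{q+4}+x^{q^2+4}+x^{4q+1}$$ is a permutation polynomial over $\mathbb{F}_{q^3}$ if and only if $m$ is odd.
   Context: $\mathbb{F}_{q^3}$ denotes the finite field with $q^3$ elements. A polynomial $f\in\mathbb{F}_{q^3}[x]$ is a permutation polynomial over $\mathbb{F}_{q^3}$ if the associated map $c\mapsto f(c)$ from $\mathbb{F}_{q^3}$ to itself is a bijection. *)

(* Defs.v *)
From mathcomp Require Import all_boot all_algebra.

Set Implicit Arguments.
Unset Strict Implicit.
Unset Printing Implicit Defensive.

Import GRing.Theory.
Local Open Scope ring_scope.

Definition permutation_poly (F : finFieldType) (f : {poly F}) : Prop :=
  bijective (fun c : F => f.[c]).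

Definition pentanomial (F : finFieldType) (q : nat) : {poly F} :=
  'X + 'X^(4 * q ^ 2 + 1)%N + 'X^(q + 4)%N + 'X^(q ^ 2 + 4)%N
     + 'X^(4 * q + 1)%N.

(* Main.v *)
Require Import Defs.
From mathcomp Require Import all_boot all_algebra.
From mathcomp Require Import all_field ring zify.

(** Put [T = x + x^q + x^(q^2)].  In characteristic 2 the pentanomial takes the
    value [x + T^4 x + T x^4], whose trace is again [T].  Hence it permutes the
    field iff for every [T] in [F_q] the additive map
    [d |-> d + T^4 d + T d^4] has no nonzero zero of trace 0, that is, iff
    [T d^3 = (1 + T)^4] has no solution [d <> 0] of trace 0.  If [m] is odd,
    cubing is injective, so such a [d] lies in [F_q] and equals its own trace.
    If [m] is even, choose [t] such that [t^(q-1)] is a primitive cube root of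
    unity and let [h = t^3]; then [T = h / (h + 1)] and [d = 1 / (t (h + 1))]
    is a solution of trace 0. *)

Set Implicit Arguments.
Unset Strict Implicit.
Unset Printing Implicit Defensive.

Import GRing.Theory.
Local Open Scope ring_scope.

Section Pchar2.

Variables (F : finFieldType) (m : nat).
Hypothesis charF : 2 \in [pchar F].
Local Notation q := (2 ^ m)%N.

Lemma two_eq0 : 2 = 0 :> F.
Proof. by have /andP[_ /eqP] := charF. Qed.

Lemma eq_addr0 (a b : F) : a + b = 0 -> a = b.
Proof. by move/addr0_eq <-; rewrite (oppr_pchar2 charF). Qed.

Lemma frobD (a b : F) : (a + b) ^+ q = a ^+ q + b ^+ q.
Proof. by apply: exprDn_pchar; rewrite (eq_pnat _ (pcharf_eq charF)) pnatX pnat_id. Qed.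

Lemma addr_X4 (a b : F) : (a + b) ^+ 4 = a ^+ 4 + b ^+ 4.
Proof. by rewrite exprDn_pchar // (eq_pnat _ (pcharf_eq charF)). Qed.

Definition trace3 (x : F) : F := x + x ^+ q + x ^+ (q ^ 2).

Lemma trace3D (x y : F) : trace3 (x + y) = trace3 x + trace3 y.
Proof. by rewrite /trace3 -mulnn !exprM !frobD; ring. Qed.

Lemma trace3_fixed (x : F) : x ^+ q = x -> trace3 x = x.
Proof.
move=> xq; rewrite /trace3 -mulnn exprM !xq.
by rewrite -addrA (addrr_pchar2 charF) addr0.
Qed.

(** Fourth powers are additive, so [trace3 x ^+ 4 * x] and [trace3 x * x ^+ 4] expand to three
    monomials each; the two copies of [x ^+ 5] cancel and the other four belong to the
    pentanomial. *)
Lemma horner_pentanomial (x : F) :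
  (pentanomial F q).[x] = x + trace3 x ^+ 4 * x + trace3 x * x ^+ 4.
Proof.
rewrite /pentanomial !hornerD !hornerXn hornerX /trace3.
have expr4M n : x ^+ (4 * n)%N = (x ^+ n) ^+ 4 by rewrite mulnC exprM.
rewrite (exprD x (4 * q ^ 2) 1) (exprD x q 4) (exprD x (q ^ 2) 4) (exprD x (4 * q) 1).
rewrite !expr4M expr1.
set y := x ^+ q; set z := x ^+ (q ^ 2).
rewrite !addr_X4; apply/subr0_eq.
transitivity (- (2 * x ^+ 5) : F); first by ring.
by rewrite two_eq0 mul0r oppr0.
Qed.

Lemma trace3_frob (x : F) : #|F| = (q ^ 3)%N -> trace3 x ^+ q = trace3 x.
Proof.
move=> cardF; rewrite /trace3 !frobD -[x ^+ (q ^ 2) ^+ q]exprM -expnSr -cardF expf_card.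
by rewrite -exprM mulnn; ring.
Qed.

Lemma trace3Z (T x : F) : T ^+ q = T -> trace3 (T * x) = T * trace3 x.
Proof. by move=> Tq; rewrite /trace3 -mulnn !exprM !exprMn !Tq; ring. Qed.

Lemma trace3X4 (x : F) : trace3 (x ^+ 4) = trace3 x ^+ 4.
Proof.
rewrite /trace3 ![x ^+ 4 ^+ _]exprAC.
by rewrite !addr_X4.
Qed.

Lemma trace3_pentanomial (x : F) : #|F| = (q ^ 3)%N ->
  trace3 (pentanomial F q).[x] = trace3 x.
Proof.
move=> cardF; have Tq := trace3_frob x cardF.
have T4q : (trace3 x ^+ 4) ^+ q = trace3 x ^+ 4 by rewrite exprAC Tq.
rewrite horner_pentanomial !trace3D (trace3Z _ T4q) (trace3Z _ Tq) trace3X4.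
set T := trace3 x; transitivity (T + 2 * T ^+ 5); first by ring.
by rewrite two_eq0 mul0r addr0.
Qed.

End Pchar2.

(** If [#|F|] is 3k + 2, then 3(2k + 1) = 2 [#|F|] - 1, so raising to the power 2k + 1 inverts
    cubing. *)
Lemma expf3_inj (F : finFieldType) : (#|F| %% 3 = 2)%N -> injective (fun x : F => x ^+ 3).
Proof.
move=> card3.
have cubeK (x : F) : (x ^+ 3) ^+ ((#|F| %/ 3)%N.*2.+1) = x.
  have [->|x0] := eqVneq x 0; first by rewrite !expr0n.
  apply: (mulfI x0); rewrite -exprM -exprS.
  have -> : (3 * (#|F| %/ 3).*2.+1).+1 = (#|F| * 2)%N by lia.
  by rewrite exprM expf_card expr2.
by move=> x y /= xy; rewrite -[x]cubeK xy cubeK.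
Qed.

(** ['X^n - 1] has at most [n] roots, fewer than the nonzero elements. *)
Lemma exists_expf_neq1 (F : finFieldType) (n : nat) :
  (0 < n < #|F|.-1)%N -> exists2 g : F, g != 0 & g ^+ n != 1.
Proof.
case/andP=> n0 ltn; apply/exists_inP; apply: contraLR ltn => /exists_inPn nog.
rewrite -leqNgt -(cardC1 (0 : F)) cardE; apply: max_unity_roots => //; last exact: enum_uniq.
apply/allP=> g; rewrite mem_enum => g0; rewrite unity_rootE.
by have := nog g g0; rewrite negbK.
Qed.

Lemma expn2_mod3 (m : nat) : (2 ^ m %% 3 = if odd m then 2 else 1)%N.
Proof. by elim: m => // m IH; rewrite expnS -modnMmr IH /=; case: (odd m). Qed.

Lemma exists_expf_primitive_cube (F : finFieldType) (q : nat) :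
  #|F| = (q ^ 3)%N -> (1 < q)%N -> (q %% 3 = 1)%N ->
  exists t : F, [/\ t != 0, t ^+ q.-1 != 1 & (t ^+ q.-1) ^+ 3 = 1].
Proof.
move=> cardF q1 qmod.
(* The exponent [k * q.-1] is a third of [#|F|.-1]; if [g] does not vanish under it to 1, then
   [t = g ^+ k] works. *)
pose k := ((q ^ 2 + q + 1) %/ 3)%N.
have k3 : (k * 3 = q ^ 2 + q + 1)%N.
  apply: divnK; have := divn_eq q 3; rewrite qmod; move: (q %/ 3)%N => r ->.
  by apply/dvdnP; exists (3 * r ^ 2 + 3 * r + 1)%N; ring.
have nE : (k * q.-1 * 3 = #|F|.-1)%N.
  by rewrite mulnAC k3 cardF; case: (q) q1 => // p _; rewrite /=; lia.
have [] := @exists_expf_neq1 F (k * q.-1)%N.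
  have k0 : (0 < k)%N by lia.
  have q0 : (0 < q.-1)%N by lia.
  by rewrite -nE muln_gt0 k0 q0 ltn_Pmulr // muln_gt0 k0.
move=> g g0 gn; exists (g ^+ k); split; first exact: expf_neq0.
  by rewrite -exprM.
apply: (mulfI g0); rewrite -(exprM g) -(exprM g) nE -exprS prednK.
  by rewrite expf_card mulr1.
by rewrite cardF expn_gt0 ltnW.
Qed.

Lemma pentanomial_inj (F : finFieldType) (m : nat) :
  2 \in [pchar F] -> #|F| = ((2 ^ m) ^ 3)%N -> odd m ->
  injective (fun c : F => (pentanomial F (2 ^ m)).[c]).
Proof.
move=> charF cardF oddm a b /= fab.
have Tab : trace3 m a = trace3 m b.
  by rewrite -(trace3_pentanomial charF a cardF) fab trace3_pentanomial.
apply: (eq_addr0 charF); set d := a + b.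
have Td : trace3 m d = 0 by rewrite trace3D // Tab addrr_pchar2.
have [//|d0] := eqVneq d 0.
move: fab; rewrite !horner_pentanomial // Tab; set T := trace3 m b => fab.
have Tq : T ^+ (2 ^ m) = T by apply: trace3_frob.
have dE : T * d ^+ 3 = 1 + T ^+ 4.
  apply: (eq_addr0 charF); apply: (mulfI d0); rewrite mulr0.
  transitivity (d + T ^+ 4 * d + T * d ^+ 4); first by ring.
  rewrite {3}/d addr_X4 //.
  transitivity ((a + T ^+ 4 * a + T * a ^+ 4) + (b + T ^+ 4 * b + T * b ^+ 4)).
    by rewrite /d; ring.
  by rewrite fab addrr_pchar2.
have T0 : T != 0.
  by apply/eqP=> T0; move/eqP: dE; rewrite T0 mul0r expr0n addr0 eq_sym oner_eq0.
(* The cube of [d] is fixed by the [2 ^ m]-th power map, as [T] and [T * d ^+ 3] are. *)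
have dq : d ^+ (2 ^ m) = d.
  apply: (@expf3_inj F); first by rewrite cardF -modnXm expn2_mod3 oddm.
  apply: (mulfI T0); rewrite dE exprAC -{1}Tq -exprMn dE frobD // expr1n.
  by rewrite exprAC Tq.
by rewrite -Td trace3_fixed.
Qed.

Lemma pentanomial_not_inj (F : finFieldType) (m : nat) :
  2 \in [pchar F] -> #|F| = ((2 ^ m) ^ 3)%N -> (0 < m)%N -> ~~ odd m ->
  ~ injective (fun c : F => (pentanomial F (2 ^ m)).[c]).
Proof.
move=> charF cardF m0 evenm finj.
have q1 : (1 < 2 ^ m)%N by rewrite -(expn0 2) ltn_exp2l.
have qmod : (2 ^ m %% 3 = 1)%N by rewrite expn2_mod3 (negbTE evenm).
have [t [t0 w1 w3]] := exists_expf_primitive_cube cardF q1 qmod.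
set w := t ^+ _ in w1 w3.
have tq : t ^+ (2 ^ m) = w * t by rewrite -exprSr prednK // ltnW.
have wq : w ^+ (2 ^ m) = w.
  by rewrite (divn_eq (2 ^ m)%N 3) qmod addn1 exprS mulnC exprM w3 expr1n mulr1.
pose h := t ^+ 3.
have hq : h ^+ (2 ^ m) = h by rewrite exprAC tq exprMn w3 mul1r.
(* Since 3 divides [2 ^ m - 1], [w] is a power of [h], so [h = 1] would force [w = 1]. *)
have h1 : h + 1 != 0.
  apply: contra_neq w1 => /(eq_addr0 charF) h1.
  have -> : w = t ^+ (3 * ((2 ^ m) %/ 3))%N.
    by rewrite /w; congr (_ ^+ _); rewrite {1}(divn_eq (2 ^ m)%N 3) qmod addn1 mulnC.
  by rewrite exprM -/h h1 expr1n.
have hq1 : (h + 1) ^+ (2 ^ m) = h + 1 by rewrite frobD // hq expr1n.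
pose T := h / (h + 1); pose x := (t * (h + 1))^-1.
have Tq : T ^+ (2 ^ m) = T by rewrite exprMn exprVn hq hq1.
have x0 : x != 0 by rewrite invr_eq0 mulf_neq0.
have w0 : w != 0 by apply: expf_neq0.
have w2 : 1 + w + w ^+ 2 = 0.
  have /eqP : (w - 1) * (1 + w + w ^+ 2) = 0.
    by transitivity (w ^+ 3 - 1); [ring | rewrite w3 subrr].
  by rewrite mulf_eq0 subr_eq0 (negbTE w1) => /eqP.
(* The conjugates of [x] are its multiples by 1, [w^-1] and [w^-2], which sum to 0. *)
have Tx : trace3 m x = 0.
  have xq : x ^+ (2 ^ m) = w^-1 * x.
    by rewrite exprVn exprMn hq1 tq -mulrA invfM.
  rewrite /trace3 -mulnn exprM xq exprMn xq exprVn wq.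
  transitivity ((1 + w + w ^+ 2) * w^-1 ^+ 2 * x); first by field.
  by rewrite w2 !mul0r.
have TE : trace3 m T = T by apply: trace3_fixed.
(* Both sides equal [(h + 1)^-4]. *)
have TxE : T * x ^+ 3 = 1 + T ^+ 4.
  have -> : 1 + T ^+ 4 = (1 + T) ^+ 4 by rewrite addr_X4 // expr1n.
  have -> : 1 + T = (h + 1)^-1.
    apply: (mulIf h1); rewrite mulrDl mulfVK // mulVf // mul1r.
    by rewrite addrAC (addrr_pchar2 charF) add0r.
  rewrite /T /x invfM exprMn [_^-1 ^+ 3 in X in _ * X]exprVn -/h.
  have h0 : h != 0 by apply: expf_neq0.
  by rewrite [in LHS]exprVn; field; rewrite h0 h1.
(* The collision is between [T + x] and [T]: both have trace [T], and their values differ by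
   [x * (1 + T ^+ 4 + T * x ^+ 3)]. *)
suff: T + x = T + 0 by move/addrI/eqP; rewrite (negbTE x0).
apply: finj; rewrite /= addr0 !horner_pentanomial // trace3D // Tx TE addr0 addr_X4 //.
transitivity (T + T ^+ 4 * T + T * T ^+ 4 + x * (1 + T ^+ 4 + T * x ^+ 3)); first by ring.
by rewrite TxE (addrr_pchar2 charF) mulr0 addr0.
Qed.

Local Close Scope ring_scope.

Theorem theorem3p2 (m : nat) (q : nat) (F : finFieldType) :
  0 < m -> q = 2 ^ m -> #|F| = q ^ 3 ->
  permutation_poly (pentanomial F q) <-> odd m.
Proof.
move=> m0 -> cardF.
have charF : 2 \in [pchar F]%R.
  by apply: (@card_finPcharP F 2 (m * 3)%N); rewrite // expnM.
split=> [/bij_inj finj | oddm]; last exact/injF_bij/pentanomial_inj.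
by apply/idPn => evenm; apply: (pentanomial_not_inj charF cardF).
Qed.
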